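(* Fix finite collocation sets $\Omega^h=\{z_{\mathcal F}^i\}_{i=1}^{N_{\mathcal F}}\subset\Omega$ and $\Gamma^h=\{z_{\mathcal B}^j\}_{j=1}^{N_{\mathcal B}}\subset\Gamma$. Let $\mathcal H\subset U^h$ be a class of (restrictions to $\overline\Omega$ of) depth-$L$ neural networks $\mathbb{R}^d\to\mathbb{R}^c$ with arbitrary hidden-layer widths satisfying one of the following: (i) (ReLU networks) $\mathcal H=\mathcal H_{\mathrm{reg}}$ consists of all depth-$L$ neural networks with ReLU activation that are $C^{r_{\max}}$ at all collocation points, $r_{\max}=\max(r_{\mathcal F},r_{\mathcal B})$, and $L\ge\lceil\log_2(d+1)\rceil+1$. (ii) (Smooth-activation networks) $\mathcal H$ consists of all depth-$L$ neural networks with activation $\sigma\in C^{\ell}(\mathbb{R},\mathbb{R})$, $\ell:=N_{\mathcal F}(r_{\mathcal F}+1)+N_{\mathcal B}(r_{\mathcal B}+1)$, where $\sigma^{(k)}(a)\ne0$ for some $a\in\mathbb{R}$ and all $0\le k\le\ell$, and $L\ge2$; if $L>2$, additionally $\sigma$ is strictly monotone. If $\arg\min_{u\in\mathcal H}\mathcal J^h(u)$ has a solution, then it has infinitely many solutions in $\mathcal H$.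
   Context: Setting. $d,c,c_{\mathcal F},c_{\mathcal B},N_{\mathcal F},N_{\mathcal B}\in\mathbb{N}$, $r_{\mathcal F},r_{\mathcal B}\in\mathbb{N}_0$, $\nu\in[1,\infty)$. $\Omega\subset\mathbb{R}^d$ is a bounded domain (open, connected) with Lipschitz boundary, $\Gamma\subseteq\partial\Omega$. Given functions $F$ and $B$ (with values in $\mathbb{R}^{c_{\mathcal F}}$ and $\mathbb{R}^{c_{\mathcal B}}$) describe local, possibly nonlinear, differential operators of orders $r_{\mathcal F}$ and $r_{\mathcal B}$. Node-regular space: $U^h$ is the set of functions $u:\overline\Omega\to\mathbb{R}^c$ such that $D^\beta u$ exists classically on $\Omega^h$ for $|\beta|\le r_{\mathcal F}$ and on $\Gamma^h$ for $|\beta|\le r_{\mathcal B}$. For $u\in U^h$ put $\widehat{\mathcal F}(u)(z)=F(z,\{D^\beta u(z):|\beta|\le r_{\mathcal F}\})$, $z\in\Omega^h$, and $\widehat{\mathcal B}(u)(z)=B(z,\{D^\beta u(z):|\beta|\le r_{\mathcal B}\})$, $z\in\Gamma^h$. AD-PINN functional. Let $\mathcal D^h\subseteq\Omega^h\cup\Gamma^h$ with given data $u^*(z)\in\mathbb{R}^c$, $z\in\mathcal D^h$; $\alpha_{\mathcal F},\alpha_{\mathcal B},\alpha_{\mathcal D}\ge0$; $\omega_{\mathcal F}^z,\omega_{\mathcal B}^z,\omega_{\mathcal D}^z\in\mathbb{R}$ quadrature weights. For $u\in U^h$, $$\mathcal J^h(u)=\alpha_{\mathcal F}\sum_{z\in\Omega^h}\omega_{\mathcal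 F}^z|\widehat{\mathcal F}(u)(z)|_\nu^\nu+\alpha_{\mathcal B}\sum_{z\in\Gamma^h}\omega_{\mathcal B}^z|\widehat{\mathcal B}(u)(z)|_\nu^\nu+\alpha_{\mathcal D}\sum_{z\in\mathcal D^h}\omega_{\mathcal D}^z|u(z)-u^*(z)|_\nu^\nu ,$$ where $|\cdot|_\nu$ is the $\ell^\nu$-norm. Minimizers are global minimizers. Neural networks. A depth-$L$ neural network with activation $\sigma:\mathbb{R}\to\mathbb{R}$ is a map $f:\mathbb{R}^d\to\mathbb{R}^c$ of the form $\varphi_0(x)=x$, $\varphi_i(x)=\sigma(W_i\varphi_{i-1}(x)+b_i)$ for $i=1,\dots,L-1$ ($\sigma$ componentwise), $f(x)=W_L\varphi_{L-1}(x)+b_L$, with $W_i\in\mathbb{R}^{d_i\times d_{i-1}}$, $b_i\in\mathbb{R}^{d_i}$, $d_0=d$, $d_L=c$ and hidden widths $d_1,\dots,d_{L-1}\in\mathbb{N}$ arbitrary. ReLU is $\sigma(x)=\max\{0,x\}$. Elements of $\mathcal H$ are regarded as functions on $\overline\Omega$ (distinct solutions are distinct functions). *)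

(* Defs.v *)
From HB Require Import structures.
From mathcomp Require Import all_boot all_order all_algebra.
From mathcomp Require Import finmap.
From mathcomp Require Import all_classical all_reals all_analysis.

Set Implicit Arguments.
Unset Strict Implicit.
Unset Printing Implicit Defensive.

Import Order.TTheory GRing.Theory Num.Theory.
Import numFieldNormedType.Exports.

Local Open Scope classical_set_scope.
Local Open Scope ring_scope.

(* R^n is ['rV[R]_n] (row vectors), so a layer W x + b reads [x *m W + b] with
   [W : 'M_(m, n)].  The library norm on ['rV[R]_n] is the sup norm; it is used
   only for notions that do not depend on the choice of the norm. *)

Section Domains.
Variables (R : realType) (d : nat).

Definition boundary (A : set 'rV[R]_d) : set 'rV[R]_d := closure A `\` A°.

(* Near each boundary point, in the orthonormal coordinates y = x Q, the domain
   is the strict epigraph of a Lipschitz function of all the coordinates except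
   y_k ([col' k] erases the k-th one). *)
Definition lipschitz_boundary (Omega : set 'rV[R]_d) : Prop :=
  forall z, boundary Omega z ->
  exists (Q : 'M[R]_d) (k : 'I_d) (g : 'rV[R]_d.-1 -> R),
    [/\ Q *m Q^T = 1%:M, lipschitz g &
        \forall x \near z,
          Omega x <-> g (col' k (x *m Q)) < (x *m Q) 0 k].

Definition bounded_lipschitz_domain (Omega : set 'rV[R]_d) : Prop :=
  [/\ open Omega, connected Omega, bounded_set Omega & lipschitz_boundary Omega].

End Domains.

Section Derivatives.
Variables (R : realType) (d c : nat).
Implicit Types (u : 'rV[R]_d -> 'rV[R]_c) (s : seq 'I_d).

Definition partial (i : 'I_d) u : 'rV[R]_d -> 'rV[R]_c :=
  fun x => 'D_(delta_mx 0 i) u x.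

(* [partials [:: i1; ...; ik] u] is the derivative d_i1 (... (d_ik u)). *)
Definition partials s u : 'rV[R]_d -> 'rV[R]_c := foldr partial u s.

(* Since ['D_v] is total, existence is a separate predicate: the inner
   derivative must exist along the line x + R e_i near x, and be derivable
   at x in the direction e_i. *)
Fixpoint ex_partials s u (x : 'rV[R]_d) : Prop :=
  if s is i :: s' then
    (\forall t \near (0 : R), ex_partials s' u (x + t *: delta_mx 0 i)) /\
    derivable (partials s' u) x (delta_mx 0 i)
  else True.

(* f is C^r in a neighbourhood of z *)
Definition Cr_at (r : nat) u (z : 'rV[R]_d) : Prop :=
  \forall x \near z, forall s, (size s <= r)%N ->
    ex_partials s u x /\ {for x, continuous (partials s u)}.

End Derivatives.

Section MultiIndices.
Variable d : nat.

(* the multi-indices b in N^d with |b| <= r *)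
Definition mindex (r : nat) : finType :=
  {b : {ffun 'I_d -> 'I_r.+1} | (\sum_i b i <= r)%N}.

Definition mindex_seq r (b : mindex r) : seq 'I_d :=
  flatten [seq nseq (val b i) i | i <- enum 'I_d].

End MultiIndices.

(* A function on the closure of Omega is encoded as a total function with the
   junk value [point] outside the closure, i.e. as a fixed point of
   [u |-> u \_ (closure Omega)]; two such functions are then equal iff they
   agree on the closure. *)
Section ClosedDomain.
Variables (R : realType) (d c : nat) (Omega : set 'rV[R]_d).
Implicit Types (u : 'rV[R]_d -> 'rV[R]_c).

Definition restrictions (N : set ('rV[R]_d -> 'rV[R]_c)) :
  set ('rV[R]_d -> 'rV[R]_c) := [set f \_ (closure Omega) | f in N].

(* D^b u (z) = d_1^b_1 ... d_d^b_d u (z), for z in the closure of Omega.  At a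
   boundary point a difference quotient may leave the closure, so there a
   derivative of positive order is the continuous extension of the derivative
   taken in Omega.  If u is the restriction of a map that is C^|b| near z, it
   is D^b of that map. *)
Definition Dmi r (b : mindex d r) u (z : 'rV[R]_d) : 'rV[R]_c :=
  let s := mindex_seq b in
  if (z \in Omega) || (s == [::]) then partials s u z
  else lim (partials s u x @[x --> within Omega (nbhs z)]).

Definition ex_Dmi r (b : mindex d r) u (z : 'rV[R]_d) : Prop :=
  let s := mindex_seq b in
  if (z \in Omega) || (s == [::]) then ex_partials s u z
  else [/\ u x @[x --> within Omega (nbhs z)] --> u z,
           \forall x \near within Omega (nbhs z), ex_partials s u x &
           cvg (partials s u x @[x --> within Omega (nbhs z)])].

(* U^h *)
Definition node_regular (rF rB : nat) (Omega_h Gamma_h : {fset 'rV[R]_d}) :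
  set ('rV[R]_d -> 'rV[R]_c) :=
  [set u | [/\ u \_ (closure Omega) = u,
     forall z, z \in Omega_h -> forall b : mindex d rF, ex_Dmi b u z &
     forall z, z \in Gamma_h -> forall b : mindex d rB, ex_Dmi b u z]].

Definition diff_op r cF
    (F : 'rV[R]_d -> (mindex d r -> 'rV[R]_c) -> 'rV[R]_cF) u
    (z : 'rV[R]_d) : 'rV[R]_cF :=
  F z (fun b => Dmi b u z).

Definition lnorm n (nu : R) (v : 'rV[R]_n) : R :=
  (\sum_i `|v 0 i| `^ nu) `^ nu^-1.

(* J^h *)
Definition pinn_loss (nu : R) rF rB cF cB
    (F : 'rV[R]_d -> (mindex d rF -> 'rV[R]_c) -> 'rV[R]_cF)
    (B : 'rV[R]_d -> (mindex d rB -> 'rV[R]_c) -> 'rV[R]_cB)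
    (Omega_h Gamma_h D_h : {fset 'rV[R]_d})
    (ustar : 'rV[R]_d -> 'rV[R]_c)
    (alphaF alphaB alphaD : R) (omegaF omegaB omegaD : 'rV[R]_d -> R) u : R :=
  alphaF * (\sum_(z <- Omega_h) omegaF z * lnorm nu (diff_op F u z) `^ nu)
  + alphaB * (\sum_(z <- Gamma_h) omegaB z * lnorm nu (diff_op B u z) `^ nu)
  + alphaD * (\sum_(z <- D_h) omegaD z * lnorm nu (u z - ustar z) `^ nu).

End ClosedDomain.

Definition argmin (R : realType) (T : Type) (H : set T) (J : T -> R) : set T :=
  [set u | H u /\ forall v, H v -> J u <= J v].

Section Networks.
Variables (R : realType) (d : nat).

Inductive hidden (sigma : R -> R) :
  nat -> forall n, ('rV[R]_d -> 'rV[R]_n) -> Prop :=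
| hidden0 : hidden sigma 0 (fun x => x)
| hiddenS i m n (phi : 'rV[R]_d -> 'rV[R]_m) (W : 'M[R]_(m, n)) (b : 'rV[R]_n) :
    (0 < n)%N -> hidden sigma i phi ->
    hidden sigma i.+1 (fun x => map_mx sigma (phi x *m W + b)).

(* depth L counts the affine maps, so there are L - 1 hidden layers; meant for
   L >= 1 (L = 0 is junk, the same as L = 1) *)
Definition networks (c : nat) (sigma : R -> R) (L : nat) :
  set ('rV[R]_d -> 'rV[R]_c) :=
  [set f | exists m (phi : 'rV[R]_d -> 'rV[R]_m) (W : 'M[R]_(m, c))
             (b : 'rV[R]_c),
     hidden sigma L.-1 phi /\ f = (fun x => phi x *m W + b)].

End Networks.

Section Activations.
Variable R : realType.

Definition relu (x : R) : R := Num.max 0 x.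

Definition Cl (l : nat) (sigma : R -> R) : Prop :=
  (forall k, (k < l)%N -> forall x, derivable (derive1n k sigma) x 1) /\
  (forall k, (k <= l)%N -> continuous (derive1n k sigma)).

Definition strictly_monotone (sigma : R -> R) : Prop :=
  {homo sigma : x y / x < y} \/ {homo sigma : x y /~ x < y}.

End Activations.

Definition relu_class (R : realType) (d c : nat) (Omega : set 'rV[R]_d)
    (r L : nat) (Omega_h Gamma_h : {fset 'rV[R]_d}) :
    set ('rV[R]_d -> 'rV[R]_c) :=
  restrictions Omega
    [set f | networks (@relu R) L f /\
      forall z, z \in (Omega_h `|` Gamma_h)%fset -> Cr_at r f z].

Definition smooth_class (R : realType) (d c : nat) (Omega : set 'rV[R]_d)
    (sigma : R -> R) (L : nat) : set ('rV[R]_d -> 'rV[R]_c) :=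
  restrictions Omega (networks sigma L).

(* Main.v *)
Require Import Defs.
From HB Require Import structures.
From mathcomp Require Import all_boot all_order all_algebra.
From mathcomp Require Import finmap.
From mathcomp Require Import all_classical all_reals all_analysis.
From mathcomp Require Import zify lra.
Import Order.TTheory GRing.Theory Num.Theory.
Import numFieldNormedType.Exports.
Local Open Scope classical_set_scope.
Local Open Scope ring_scope.

Set Implicit Arguments.
Unset Strict Implicit.
Unset Printing Implicit Defensive.

(** The loss sees a network only through finitely many derivatives at finitely
    many nodes, whereas networks of arbitrary width form an infinite
    dimensional space: networks of equal depth can be added ([networksD]).  It
    is therefore enough to find one network [g], not identically zero on the
    domain, all of whose derivatives that enter the loss vanish at the nodes;
    if [f] is a minimizer, so are the pairwise distinct functions
    [f + n g], n = 0, 1, 2, ... ([infinite_argmin_ridge]).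

    In both cases [g] is a ridge function [x |-> G (x_i0)] in one coordinate,
    times a constant vector, so that its partial derivatives are the
    derivatives of the one-variable function [G] ([partials_ridge]).

    For ReLU networks, [G] is a hat function whose support avoids the
    coordinates of the nodes ([hat_avoiding]).  Then [g] vanishes in a
    neighbourhood of each node, so that adding it also preserves the regularity
    of [f] there.  The hat needs one hidden layer, and since it is nonnegative
    it goes through further ReLU layers unchanged ([computed_hat]).

    For smooth activations, let [q] be the (L - 2)-fold iterate of [sigma], and
    let [G] be a combination of the l + 1 neurons
    [sigma (k (q t - q t0) + a)], [k = 0, ..., l].  The conditions
    at the nodes are at most l homogeneous linear equations on the l + 1
    coefficients, so they have a nonzero solution.  The resulting [G] is not
    zero near [t0]: since [q] is continuous and strictly monotone, it covers a
    neighbourhood of [q t0], and there the neurons are linearly independent, by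
    a Vandermonde argument on their derivatives at [a]
    ([activation_free], [smooth_combination]). *)

(** * Iterated partial derivatives *)

Section IteratedPartials.
Variables (R : realType) (d c : nat).
Implicit Types (f g : 'rV[R]_d -> 'rV[R]_c) (s : seq 'I_d) (x : 'rV[R]_d).

(** [ex_partials] only controls a function along lines, whereas the locality
    lemmas for derivatives ask for a full neighbourhood; passing to the
    restriction to a line bridges the two. *)
Lemma derivable_line f x v :
  derivable f x v <-> derivable (fun h : R => f (x + h *: v)) 0 1.
Proof.
rewrite derivable1P; suff -> : (fun h : R => f (h *: v + x)) =
  (fun h : R => f (x + h *: v)) by [].
by apply/funext => h; rewrite addrC.
Qed.

Lemma derive_line f x v :
  'D_v f x = 'D_1 (fun h : R => f (x + h *: v)) 0.
Proof.
rewrite /derive; set g1 := (X in lim (X @ _)); set g2 := (X in _ = lim (X @ _)).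
suff -> : g1 = g2 by [].
apply/funext => h; rewrite /g1 /g2 /=.
by rewrite addr0 scale0r addr0 [_%:A]mulr1 [_ + x]addrC.
Qed.

Lemma partials_near s f g x :
  {near x, f =1 g} -> partials s f x = partials s g x.
Proof.
elim: s x => [|i s IH] x fg /=; first exact: nbhs_singleton fg.
apply: near_eq_derive; apply: filterS (near_join fg) => y; exact: IH.
Qed.

(** Existence has to be assumed for both summands: the operator ['D_v] is total
    and is additive only where the limits exist.  The induction works because
    [ex_partials] at [x] gives existence along a whole segment through [x] in
    the outermost direction, so that there the inner derivative of the sum is
    the sum of the inner derivatives. *)
Lemma partialsD s f g x :
  ex_partials s f x -> ex_partials s g x ->
  ex_partials s (f \+ g) x /\
  partials s (f \+ g) x = partials s f x + partials s g x.
Proof.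
elim: s x => [|i s IH] x; first by split.
move=> [nf df] [ng dg].
set e : 'rV[R]_d := delta_mx 0 i.
have nfg : \forall t \near (0 : R), ex_partials s (f \+ g) (x + t *: e) /\
    partials s (f \+ g) (x + t *: e) =
    partials s f (x + t *: e) + partials s g (x + t *: e).
  by apply: filterS2 nf ng => t; exact: IH.
pose line (u : 'rV[R]_d -> 'rV[R]_c) := fun t : R => partials s u (x + t *: e).
have neq : \forall t \near (0 : R),
    (line f + line g) t = line (f \+ g) t.
  by apply: filterS nfg => t [_ eqt]; rewrite [RHS]eqt.
have dlf : derivable (line f) 0 1 by apply: (iffLR (derivable_line _ _ _)) df.
have dlg : derivable (line g) 0 1 by apply: (iffLR (derivable_line _ _ _)) dg.
split; [split|].
- by apply: filterS nfg => t [].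
- apply: (iffRL (derivable_line _ _ _)).
  exact: (near_eq_derivable neq (derivableD dlf dlg)).
- have E u : partials (i :: s) u x = 'D_1 (line u) 0 by exact: derive_line.
  rewrite !E -(deriveD dlf dlg); symmetry; exact: near_eq_derive neq.
Qed.

End IteratedPartials.

(** * Ridge functions in one coordinate *)

Section Ridge.
Variables (R : realType) (d c : nat) (i0 : 'I_d).
Implicit Types (G : R -> R) (v : 'rV[R]_c) (s : seq 'I_d) (x : 'rV[R]_d).

Definition ridge G v : 'rV[R]_d -> 'rV[R]_c := fun x => G (x 0 i0) *: v.

(** The smoothness clauses are required in a neighbourhood because both [Cr_at]
    and the derivatives at boundary points look at points near the node. *)
Definition flat (r : nat) G (t : R) : Prop :=
  [/\ \forall t' \near t, forall j, (j < r)%N -> derivable (derive1n j G) t' 1,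
      \forall t' \near t, forall j, (j <= r)%N ->
        {for t', continuous (derive1n j G)} &
      forall j, (j <= r)%N -> derive1n j G t = 0].

Lemma near_coord x (P : R -> Prop) :
  (\forall t \near (x 0 i0), P t) -> \forall y \near x, P ((y : 'rV[R]_d) 0 i0).
Proof. exact: (@coord_continuous R 1 d 0 i0 x). Qed.

Lemma is_derive_line_scalel G v a :
  derivable G a 1 ->
  is_derive (0 : R) 1 (fun t => G (a + t) *: v) (derive1 G a *: v).
Proof.
move=> dG; have lim : h^-1 *: (((fun t => G (a + t) *: v) \o shift 0) (h *: 1) -
    G (a + 0) *: v) @[h --> (0 : R)^'] --> derive1 G a *: v.
  rewrite (_ : (fun h => _) = fun h : R =>
      (h^-1 *: ((G \o shift a) (h *: 1) - G a)) *: v); last first.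
    apply/funext => h /=.
    by rewrite !addr0 -scalerBl scalerA [a + _]addrC.
  by apply: cvgZr_tmp; rewrite derive1E; exact: dG.
by apply: DeriveDef; [exact: cvgP lim|exact: cvg_lim lim].
Qed.

(** A ridge function is constant in every direction other than [i0], and along
    direction [i0] it is a translate of [G]; hence an iterated partial
    derivative either vanishes or is the one-variable derivative of the same
    order. *)
Lemma partials_ridge G v s x :
  (\forall t \near (x 0 i0), forall j, (j < size s)%N ->
     derivable (derive1n j G) t 1) ->
  ex_partials s (ridge G v) x /\
  partials s (ridge G v) x =
    (if all (pred1 i0) s then derive1n (size s) G (x 0 i0) else 0) *: v.
Proof.
elim: s x => [|i s IH] x dG; first by split.
set e : 'rV[R]_d := delta_mx 0 i.
have line t : (x + t *: e) 0 i0 = x 0 i0 + t * (i0 == i)%:R.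
  by rewrite !mxE eqxx.
have cline : x 0 i0 + t * (i0 == i)%:R @[t --> (0 : R)] --> x 0 i0.
  rewrite -[X in _ --> X]addr0; apply: cvgD; first exact: cvg_cst.
  rewrite -[X in _ --> X](mul0r (i0 == i)%:R).
  by apply: cvgMl; exact: cvg_id.
have near_line : \forall t \near (0 : R),
   ex_partials s (ridge G v) (x + t *: e) /\
   partials s (ridge G v) (x + t *: e) =
    (if all (pred1 i0) s then
       derive1n (size s) G (x 0 i0 + t * (i0 == i)%:R) else 0) *: v.
  have dGl : \forall t \near (0 : R),
      \forall t' \near x 0 i0 + t * (i0 == i)%:R,
      forall j, (j < (size s).+1)%N -> derivable (derive1n j G) t' 1.
    exact: cline _ (near_join dG).
  apply: filterS dGl => t dGt; rewrite -line; apply: IH.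
  rewrite line; apply: filterS dGt => t' dG' j js.
  by apply: dG'; exact: ltnW.
have [dl Dl] : is_derive (0 : R) 1
    (fun t : R => partials s (ridge G v) (x + t *: e))
    ((if all (pred1 i0) (i :: s) then derive1n (size s).+1 G (x 0 i0) else 0)
      *: v).
  apply: (near_eq_is_derive (f := fun t : R => (if all (pred1 i0) s then
       derive1n (size s) G (x 0 i0 + t * (i0 == i)%:R) else 0) *: v)).
    by apply: filterS near_line => t [_ ->].
  have cst0 (w : 'rV[R]_c) : is_derive (0 : R) 1 (fun=> w) (0 *: v).
    by rewrite scale0r; exact: is_derive_cst.
  rewrite /= [i == i0]eq_sym; case: (all _ s); last by rewrite andbF; exact: cst0.
  rewrite andbT; case: (i0 == i); last first.
    have -> : (fun t : R => derive1n (size s) G (x 0 i0 + t * false%:R) *: v) =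
        (fun=> derive1n (size s) G (x 0 i0) *: v).
      by apply/funext => t; rewrite mulr0 addr0.
    exact: cst0.
  have -> : (fun t : R => derive1n (size s) G (x 0 i0 + t * true%:R) *: v) =
      (fun t => derive1n (size s) G (x 0 i0 + t) *: v).
    by apply/funext => t; rewrite mulr1.
  apply: is_derive_line_scalel; exact: (nbhs_singleton dG).
split; [split|].
- by apply: filterS near_line => t [].
- exact: (iffRL (derivable_line _ _ _)) dl.
- by rewrite -Dl; exact: derive_line.
Qed.

Lemma ridge_smooth r G v x :
  (\forall t \near (x 0 i0), forall j, (j < r)%N ->
     derivable (derive1n j G) t 1) ->
  (\forall t \near (x 0 i0), forall j, (j <= r)%N ->
     {for t, continuous (derive1n j G)}) ->
  Cr_at r (ridge G v) x.
Proof.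
move=> dG cG.
have nG : \forall y \near x,
    (\forall t \near ((y : 'rV[R]_d) 0 i0), forall j, (j < r)%N ->
      derivable (derive1n j G) t 1) /\
    (forall j, (j <= r)%N -> {for y 0 i0, continuous (derive1n j G)}).
  exact: filterI (near_coord (near_join dG)) (near_coord cG).
apply: filterS (near_join nG) => y nGy s sr.
have near_s : \forall y' \near y, ex_partials s (ridge G v) y' /\
  partials s (ridge G v) y' =
    (if all (pred1 i0) s then derive1n (size s) G (y' 0 i0) else 0) *: v.
  apply: filterS nGy => y' [dG' _]; apply: partials_ridge.
  by apply: filterS dG' => t dGt j js; apply: dGt; exact: leq_trans js sr.
have [Ey Dy] := nbhs_singleton near_s; split=> //.
suff : partials s (ridge G v) y' @[y' --> y] --> partials s (ridge G v) y by [].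
pose h (y' : 'rV[R]_d) : 'rV[R]_c :=
  (if all (pred1 i0) s then derive1n (size s) G (y' 0 i0) else 0) *: v.
have hE : \forall y' \near y, h y' = partials s (ridge G v) y'.
  by apply: filterS near_s => y' [_ ->].
rewrite Dy; apply: cvg_trans (near_eq_cvg hE) _; rewrite /h.
apply: cvgZr_tmp; case: all; last exact: cvg_cst.
apply: (@continuous_comp _ _ _ (fun y' : 'rV[R]_d => y' 0 i0)
  (derive1n (size s) G)); first exact: coord_continuous.
by have [_ cGy] := nbhs_singleton nGy; exact: cGy.
Qed.

(** Reduces the vanishing of all the partial derivatives of order at most [r]
    at a point to [r + 1] scalar equations on [G]; this is where the count
    of the equations in the smooth case comes from. *)
Lemma flat_ridge r G v x : flat r G (x 0 i0) ->
  Cr_at r (ridge G v) x /\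
  forall s, (size s <= r)%N -> partials s (ridge G v) x = 0.
Proof.
move=> [dG cG G0]; split; first exact: ridge_smooth dG cG.
move=> s sr; have [|_ ->] := @partials_ridge G v s x.
  by apply: filterS dG => t dGt j js; apply: dGt; exact: leq_trans js sr.
by rewrite G0// if_same scale0r.
Qed.
End Ridge.

(** * Flat perturbations leave the loss unchanged *)

Section Perturbation.
Variables (R : realType) (d c : nat).
Implicit Types (f g u : 'rV[R]_d -> 'rV[R]_c) (z : 'rV[R]_d).

Lemma size_mindex_seq r (b : mindex d r) : (size (mindex_seq b) <= r)%N.
Proof.
rewrite /mindex_seq size_flatten /shape -map_comp sumnE big_map big_enum /=.
under eq_bigr do rewrite size_nseq.
exact: (valP b).
Qed.

Lemma Cr_atD r f g z : Cr_at r f z -> Cr_at r g z -> Cr_at r (f \+ g) z.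
Proof.
move=> Cf Cg; apply: filterS2 (near_join Cf) (near_join Cg) => y Cfy Cgy s sr.
have D : \forall y' \near y, ex_partials s (f \+ g) y' /\
    partials s (f \+ g) y' = partials s f y' + partials s g y'.
  by apply: filterS2 Cfy Cgy => y' Cfy' Cgy'; apply: partialsD;
    [case: (Cfy' s sr)|case: (Cgy' s sr)].
have [Ey Dy] := nbhs_singleton D; split=> //.
have [_ cf] := nbhs_singleton Cfy s sr.
have [_ cg] := nbhs_singleton Cgy s sr.
suff : partials s (f \+ g) y' @[y' --> y] --> partials s (f \+ g) y by [].
pose h y' := partials s f y' + partials s g y'.
have hE : \forall y' \near y, h y' = partials s (f \+ g) y'.
  by apply: filterS D => y' [_ ->].
by rewrite Dy; apply: cvg_trans (near_eq_cvg hE) _; exact: cvgD cf cg.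
Qed.

Definition flat_at r g z :=
  Cr_at r g z /\ forall s, (size s <= r)%N -> partials s g z = 0.

Lemma flat_at0 r g z : flat_at r g z -> g z = 0.
Proof. by move=> [_ /(_ [::])]; exact. Qed.

Variable Omega : set 'rV[R]_d.
Hypothesis openO : open Omega.

Lemma partialsD_restrict s f g x : Omega x ->
  ex_partials s (f \_ (closure Omega)) x -> ex_partials s g x ->
  partials s ((f \+ g) \_ (closure Omega)) x =
  partials s (f \_ (closure Omega)) x + partials s g x.
Proof.
move=> Ox Ef Eg; have [_ <-] := partialsD Ef Eg.
apply: partials_near.
have : \forall y \near x, Omega y by exact: open_nbhs_nbhs.
apply: filterS => y Oy; rewrite /= !patchE mem_set//; exact: subset_closure.
Qed.

(** In the interior this is additivity of the derivative.  At a boundary node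
    [D^b] is the limit of the derivative taken inside the domain; the
    derivative of [g] is continuous at [z] and vanishes there, so that it does
    not contribute to the limit. *)
Lemma Dmi_flat r (b : mindex d r) f g z : closure Omega z ->
  ex_Dmi Omega b (f \_ (closure Omega)) z -> flat_at r g z ->
  Dmi Omega b ((f \+ g) \_ (closure Omega)) z =
  Dmi Omega b (f \_ (closure Omega)) z.
Proof.
rewrite /ex_Dmi /Dmi => clz; set s := mindex_seq b.
have sr : (size s <= r)%N := size_mindex_seq b.
move=> exf flg; have [Cg g0] := flg; case: ifPn exf => [/orP[zO|/eqP s0]|/norP[zO s0]].
- move=> Ef; rewrite partialsD_restrict//; first by rewrite g0// addr0.
    exact: set_mem.
  by have [] := nbhs_singleton Cg s sr.
- move=> _; rewrite s0 /= !patchE mem_set//=.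
  by rewrite (flat_at0 flg) addr0.
- move=> [_ Ef cf].
  have PF : ProperFilter (within Omega (nbhs z)) by exact: within_nbhs_proper.
  apply: cvg_lim => //.
  pose h x := partials s (f \_ (closure Omega)) x + partials s g x.
  have hE : \forall x \near within Omega (nbhs z),
      h x = partials s ((f \+ g) \_ (closure Omega)) x.
    have Og : \forall x \near within Omega (nbhs z), ex_partials s g x.
      by apply: cvg_within; apply: filterS Cg => y /(_ s sr)[].
    apply: filterS3 Og Ef (withinT _ _) => x Egx Efx Ox.
    by rewrite partialsD_restrict.
  have gl : partials s g x @[x --> within Omega (nbhs z)] --> (0 : 'rV[R]_c).
    rewrite -(g0 s sr); have [_ cg] := nbhs_singleton Cg s sr.
    exact: cvg_trans (cvg_app _ (@cvg_within _ _ _ _)) cg.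
  rewrite -[X in _ --> X](addr0 (lim _)).
  exact: cvg_trans (near_eq_cvg hE) (cvgD cf gl).
Qed.

Lemma pinn_loss_eq nu rF rB cF cB
    (F : 'rV[R]_d -> (mindex d rF -> 'rV[R]_c) -> 'rV[R]_cF)
    (B : 'rV[R]_d -> (mindex d rB -> 'rV[R]_c) -> 'rV[R]_cB)
    (Omega_h Gamma_h D_h : {fset 'rV[R]_d}) ustar
    alphaF alphaB alphaD omegaF omegaB omegaD u u' :
  (forall z, z \in Omega_h -> forall b : mindex d rF,
     Dmi Omega b u' z = Dmi Omega b u z) ->
  (forall z, z \in Gamma_h -> forall b : mindex d rB,
     Dmi Omega b u' z = Dmi Omega b u z) ->
  (forall z, z \in D_h -> u' z = u z) ->
  pinn_loss Omega nu F B Omega_h Gamma_h D_h ustar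
    alphaF alphaB alphaD omegaF omegaB omegaD u' =
  pinn_loss Omega nu F B Omega_h Gamma_h D_h ustar
    alphaF alphaB alphaD omegaF omegaB omegaD u.
Proof.
move=> eqF eqB eqD; rewrite /pinn_loss.
have EF : \sum_(z <- Omega_h) omegaF z * lnorm nu (diff_op Omega F u' z) `^ nu =
    \sum_(z <- Omega_h) omegaF z * lnorm nu (diff_op Omega F u z) `^ nu.
  apply: eq_big_seq => z zO.
  suff -> : diff_op Omega F u' z = diff_op Omega F u z by [].
  by rewrite /diff_op; congr (F z _); apply/funext => b; exact: eqF.
have EB : \sum_(z <- Gamma_h) omegaB z * lnorm nu (diff_op Omega B u' z) `^ nu =
    \sum_(z <- Gamma_h) omegaB z * lnorm nu (diff_op Omega B u z) `^ nu.
  apply: eq_big_seq => z zG.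
  suff -> : diff_op Omega B u' z = diff_op Omega B u z by [].
  by rewrite /diff_op; congr (B z _); apply/funext => b; exact: eqB.
have ED : \sum_(z <- D_h) omegaD z * lnorm nu (u' z - ustar z) `^ nu =
    \sum_(z <- D_h) omegaD z * lnorm nu (u z - ustar z) `^ nu.
  by apply: eq_big_seq => z zD; rewrite eqD.
exact: (f_equal3 (fun p q r => alphaF * p + alphaB * q + alphaD * r) EF EB ED).
Qed.

End Perturbation.

Lemma infinite_argmin (R : realType) (T : Type) (H : set T) (J : T -> R)
    (u : T) (w : nat -> T) :
  argmin H J u -> (forall n, H (w n) /\ J (w n) = J u) -> injective w ->
  infinite_set (argmin H J).
Proof.
move=> [Hu umin] Hw winj.
apply: (@sub_infinite_set _ (range w)).
  by move=> _ [n _ <-]; have [Hwn Jwn] := Hw n; split=> // v Hv; rewrite Jwn umin.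
move=> /(finite_preimage (f := w)) fw; apply: infinite_nat.
apply: sub_finite_set (fw _); first by move=> n _; exists n.
by move=> m n _ _; exact: winj.
Qed.

Section RidgePerturbation.
Variables (R : realType) (d c cF cB rF rB : nat) (nu : R).
Hypothesis c_gt0 : (0 < c)%N.
Variables (Omega Gamma : set 'rV[R]_d).
Hypotheses (openO : open Omega) (Gamma_sub : Gamma `<=` boundary Omega).
Variables (F : 'rV[R]_d -> (mindex d rF -> 'rV[R]_c) -> 'rV[R]_cF)
  (B : 'rV[R]_d -> (mindex d rB -> 'rV[R]_c) -> 'rV[R]_cB)
  (Omega_h Gamma_h D_h : {fset 'rV[R]_d}).
Hypotheses (Omega_h_sub : [set` Omega_h] `<=` Omega)
  (Gamma_h_sub : [set` Gamma_h] `<=` Gamma)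
  (D_h_sub : (D_h `<=` Omega_h `|` Gamma_h)%fset).
Variables (ustar : 'rV[R]_d -> 'rV[R]_c) (alphaF alphaB alphaD : R)
  (omegaF omegaB omegaD : 'rV[R]_d -> R).
Variable N : set ('rV[R]_d -> 'rV[R]_c).
Hypothesis N_regular :
  restrictions Omega N `<=` node_regular Omega rF rB Omega_h Gamma_h.
Variables (i0 : 'I_d) (G : R -> R).
Hypothesis N_ridge : forall f v, N f -> N (f \+ ridge i0 G v).
Hypothesis G_flatF : forall z, z \in Omega_h -> flat rF G (z 0 i0).
Hypothesis G_flatB : forall z, z \in Gamma_h -> flat rB G (z 0 i0).
Hypothesis G_neq0 : exists2 x, Omega x & G (x 0 i0) != 0.

Let J := pinn_loss Omega nu F B Omega_h Gamma_h D_h ustar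
             alphaF alphaB alphaD omegaF omegaB omegaD.

(** The common part of the two cases: if adding the ridge functions [G (x_i0) v]
    does not leave the class of networks, and [G] is flat at every node without
    vanishing on the domain, then [n |-> f + G (x_i0) (n, ..., n)] is an
    injective sequence of minimizers as soon as [f] gives one. *)
Lemma infinite_argmin_ridge :
  argmin (restrictions Omega N) J !=set0 ->
  infinite_set (argmin (restrictions Omega N) J).
Proof.
move=> [_ [[f Nf <-] fmin]]; set u := f \_ (closure Omega).
pose g (n : nat) := ridge i0 G (const_mx n%:R : 'rV[R]_c).
have Hu : restrictions Omega N u by exists f.
have [_ regF regB] := N_regular Hu.
have O_cl z : z \in Omega_h -> closure Omega z.
  by move=> zO; apply: subset_closure; exact: Omega_h_sub.
have G_cl z : z \in Gamma_h -> closure Omega z.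
  by move=> zG; have [] := Gamma_sub (Gamma_h_sub zG).
have flatF n z : z \in Omega_h -> flat_at rF (g n) z.
  by move=> zO; exact: flat_ridge (G_flatF zO).
have flatB n z : z \in Gamma_h -> flat_at rB (g n) z.
  by move=> zG; exact: flat_ridge (G_flatB zG).
have same_value n z : closure Omega z -> g n z = 0 ->
    ((f \+ g n) \_ (closure Omega)) z = u z.
  by move=> /mem_set clz gz; rewrite /u !patchE clz /= gz addr0.
apply: (@infinite_argmin _ _ _ _ u (fun n => (f \+ g n) \_ (closure Omega))).
- by split.
- move=> n; split; first by exists (f \+ g n) => //; exact: N_ridge.
  apply: pinn_loss_eq => z zh.
  + by move=> b; apply: Dmi_flat; [|exact: O_cl|exact: regF|exact: flatF].
  + by move=> b; apply: Dmi_flat; [|exact: G_cl|exact: regB|exact: flatB].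
  + have : z \in (Omega_h `|` Gamma_h)%fset by exact: (fsubsetP D_h_sub).
    rewrite in_fsetU => /orP[zO|zG].
      by apply: same_value; [exact: O_cl|exact: flat_at0 (flatF n z zO)].
    by apply: same_value; [exact: G_cl|exact: flat_at0 (flatB n z zG)].
- move=> m n eqmn.
  (* at a point where [G] does not vanish, the values determine [n] *)
  have [x Ox Gx] := G_neq0.
  have := congr1 (fun w : 'rV[R]_d -> 'rV[R]_c => w x) eqmn.
  rewrite /= !patchE mem_set; last exact: subset_closure.
  move=> /addrI /(congr1 (fun w : 'rV[R]_c => w 0 (Ordinal c_gt0))).
  rewrite !mxE => /(mulfI Gx) /eqP; rewrite eqr_nat => /eqP; exact.
Qed.

End RidgePerturbation.

(** * Sums of networks of equal depth *)

Section NetworkAlgebra.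
Variables (R : realType) (d : nat) (sigma : R -> R).

(** The first layer is stated with a matrix [P], and not as an equality of the
    widths [d] and [n], so that no cast is needed: only linear images of the
    hidden layers matter. *)
Lemma hidden_inv i n (phi : 'rV[R]_d -> 'rV[R]_n) : hidden sigma i phi ->
  match i with
  | 0 => exists P : 'M[R]_(d, n), phi = fun x => x *m P
  | i'.+1 => exists m (psi : 'rV[R]_d -> 'rV[R]_m) (W : 'M[R]_(m, n)) b,
      [/\ (0 < n)%N, hidden sigma i' psi &
          phi = fun x => map_mx sigma (psi x *m W + b)]
  end.
Proof.
case=> [|i' m n' psi W b n0 hpsi]; last by exists m, psi, W, b.
by exists 1%:M; apply/funext => x; rewrite mulmx1.
Qed.

(** Two networks run in parallel: stacking the layers gives one network of
    the same depth, from which both can be read off by projections.  At level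
    0 the two networks share the input itself, which is why the projections
    are arbitrary matrices. *)
Lemma hidden_join i m1 m2 (phi1 : 'rV[R]_d -> 'rV[R]_m1)
    (phi2 : 'rV[R]_d -> 'rV[R]_m2) :
  hidden sigma i phi1 -> hidden sigma i phi2 ->
  exists m (phi : 'rV[R]_d -> 'rV[R]_m) (P1 : 'M[R]_(m, m1))
    (P2 : 'M[R]_(m, m2)),
    [/\ hidden sigma i phi, phi1 = (fun x => phi x *m P1) &
        phi2 = (fun x => phi x *m P2)].
Proof.
elim: i m1 m2 phi1 phi2 => [|i IH] m1 m2 phi1 phi2.
  move=> /hidden_inv[P1 ->] /hidden_inv[P2 ->].
  exists d, id, P1, P2; split=> //; exact: hidden0.
move=> /hidden_inv[n1 [psi1 [W1 [b1 [m1_gt0 h1 ->]]]]].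
move=> /hidden_inv[n2 [psi2 [W2 [b2 [m2_gt0 h2 ->]]]]].
have [n [psi [Q1 [Q2 [hpsi -> ->]]]]] := IH _ _ _ _ h1 h2.
exists (m1 + m2)%N, (fun x => map_mx sigma
  (psi x *m row_mx (Q1 *m W1) (Q2 *m W2) + row_mx b1 b2)).
exists (col_mx 1%:M 0), (col_mx 0 1%:M); split.
- by apply: hiddenS => //; rewrite addn_gt0 m1_gt0.
- apply/funext => x; rewrite mul_mx_row add_row_mx map_row_mx mul_row_col.
  by rewrite mulmx1 mulmx0 addr0 mulmxA.
- apply/funext => x; rewrite mul_mx_row add_row_mx map_row_mx mul_row_col.
  by rewrite mulmx1 mulmx0 add0r mulmxA.
Qed.

Lemma networksD c L (f g : 'rV[R]_d -> 'rV[R]_c) :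
  networks sigma L f -> networks sigma L g -> networks sigma L (f \+ g).
Proof.
move=> [m1 [phi1 [W1 [b1 [h1 ->]]]]] [m2 [phi2 [W2 [b2 [h2 ->]]]]].
have [m [phi [P1 [P2 [h -> ->]]]]] := hidden_join h1 h2.
exists m, phi, (P1 *m W1 + P2 *m W2), (b1 + b2); split=> //.
by apply/funext => x; rewrite /= mulmxDr !mulmxA addrACA.
Qed.

(** Scalar functions that are linear combinations of the outputs of the [i]-th
    hidden layer of some network. *)
Definition computed (i : nat) (h : 'rV[R]_d -> R) : Prop :=
  exists m (phi : 'rV[R]_d -> 'rV[R]_m) (w : 'cV[R]_m),
    hidden sigma i phi /\ forall x, (phi x *m w) 0 0 = h x.

Lemma computed_coord (i0 : 'I_d) : computed 0 (fun x => x 0 i0).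
Proof.
exists d, id, (delta_mx i0 0); split; first exact: hidden0.
move=> x; rewrite mxE (bigD1 i0)//= mxE !eqxx mulr1 big1 ?addr0// => j ji0.
by rewrite mxE (negbTE ji0) mulr0.
Qed.

Lemma computed_layer i h n (l b a : 'rV[R]_n) : (0 < n)%N -> computed i h ->
  computed i.+1 (fun x => \sum_(k < n) a 0 k * sigma (l 0 k * h x + b 0 k)).
Proof.
move=> n0 [m [phi [w [hphi phiE]]]].
exists n, (fun x => map_mx sigma (phi x *m (w *m l) + b)), a^T.
split; first exact: hiddenS.
move=> x; rewrite mxE; apply: eq_bigr => k _.
rewrite [a^T _ _]mxE mulrC; congr (_ * _); rewrite mxE; congr (sigma _).
by rewrite mulmxA [LHS]mxE; congr (_ + _); rewrite mxE big_ord1 phiE mulrC.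
Qed.

Lemma computed_activation i h : computed i h ->
  computed i.+1 (fun x => sigma (h x)).
Proof.
move=> /(@computed_layer i h 1 (const_mx 1) 0 (const_mx 1) isT).
congr (computed _ _); apply/funext => x.
by rewrite big_ord1 !mxE !mul1r addr0.
Qed.

Lemma networks_scalel c L h (v : 'rV[R]_c) :
  computed L.-1 h -> networks sigma L (fun x => h x *: v).
Proof.
move=> [m [phi [w [hphi phiE]]]].
exists m, phi, (w *m v), 0; split=> //; apply/funext => x.
rewrite addr0 mulmxA; apply/rowP => j.
by rewrite mxE [RHS]mxE big_ord1 phiE.
Qed.

End NetworkAlgebra.

(** * The ReLU case: a hat function between the nodes *)

Section VanishingNearby.
Variable R : realType.

Lemma derive1n_near (f g : R -> R) n t :
  {near t, f =1 g} -> derive1n n f t = derive1n n g t.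
Proof.
elim: n t => [|n IH] t fg; first exact: nbhs_singleton fg.
rewrite !derive1nS !derive1E; apply: near_eq_derive.
by apply: filterS (near_join fg) => t'; exact: IH.
Qed.

Lemma derive1n_cst0 n : derive1n n (fun=> 0 : R) = (fun=> 0).
Proof.
elim: n => [//|n IH]; rewrite derive1nS IH; apply/funext => t.
exact: derive1_cst.
Qed.

Lemma flat_near0 r (G : R -> R) t : (\forall t' \near t, G t' = 0) -> flat r G t.
Proof.
move=> G0; have near_eq : \forall t' \near t, forall n,
    {near t', derive1n n G =1 (fun=> 0)}.
  apply: filterS (near_join (near_join G0)) => t' G0' n.
  apply: filterS G0' => t'' G0''.
  by rewrite (derive1n_near _ G0'') derive1n_cst0.
split.
- apply: filterS near_eq => t' eq0 j _.
  apply: (@near_eq_derivable _ _ _ (fun=> 0)); last exact: derivable_cst.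
  by apply: filterS (eq0 j) => t'' ->.
- apply: filterS near_eq => t' eq0 j _.
  suff : derive1n j G t'' @[t'' --> t'] --> derive1n j G t' by [].
  rewrite (nbhs_singleton (eq0 j)).
  have e : \forall t'' \near t', (0 : R) = derive1n j G t''.
    by apply: filterS (eq0 j) => t'' ->.
  apply: cvg_trans (near_eq_cvg e) _; exact: cvg_cst.
- by move=> j _; exact: nbhs_singleton (nbhs_singleton near_eq j).
Qed.

Lemma dnbhs_notin (s : seq R) (t : R) : \forall t' \near t^', t' \notin s.
Proof.
elim: s => [|a s IH]; first by apply: nearW.
suff ta' : \forall t' \near t^', t' != a.
  by apply: filterS2 IH ta' => t' s't' t'a; rewrite inE negb_or t'a.
have [->|ta] := eqVneq t a; first exact: nbhs_dnbhs_neq.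
apply: nbhs_dnbhs; apply: open_nbhs_nbhs; split; [exact: open_neq|exact: ta].
Qed.

Lemma finite_gap (s : seq R) (p : R) : p \notin s ->
  exists2 e : R, 0 < e & forall a, a \in s -> e < `|a - p|.
Proof.
elim: s => [_|a s IH]; first by exists 1.
rewrite inE negb_or => /andP[pa /IH[e e0 es]].
have a0 : 0 < `|a - p| by rewrite normr_gt0 subr_eq0 eq_sym.
exists (Num.min e (`|a - p| / 2)); first by rewrite lt_min e0 divr_gt0.
move=> b; rewrite inE => /orP[/eqP->|/es]; rewrite gt_min.
  by rewrite [X in _ || X]ltr_pdivrMr// ltr_pMr// ltr1n orbT.
by move=> ->.
Qed.

(** The piecewise linear bump of height [e] supported on [[p - e, p + e]],
    written with three ReLU neurons. *)
Definition hat (p e t : R) : R :=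
  relu (t - p + e) - 2 * relu (t - p) + relu (t - p - e).

Lemma hat_out (p e t : R) : 0 < e -> e <= `|t - p| -> hat p e t = 0.
Proof.
rewrite /hat /relu ler_normr !maxEle => e0 /orP[] et;
  by case: (leP 0 (t - p + e)); case: (leP 0 (t - p)); case: (leP 0 (t - p - e)); lra.
Qed.

Lemma hat_center (p e : R) : 0 < e -> hat p e p = e.
Proof.
move=> e0; rewrite /hat /relu subrr add0r sub0r maxxx.
by rewrite max_r ?(ltW e0)// max_l ?oppr_le0 ?(ltW e0)// mulr0 subr0 addr0.
Qed.

Lemma hat_ge0 (p e t : R) : 0 < e -> 0 <= hat p e t.
Proof.
rewrite /hat /relu !maxEle => e0.
by case: (leP 0 (t - p + e)); case: (leP 0 (t - p)); case: (leP 0 (t - p - e)); lra.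
Qed.

(** One hidden layer suffices because the bump is a function of a single
    coordinate; further layers are harmless since ReLU fixes nonnegative
    values. *)
Lemma computed_hat d (i0 : 'I_d) (p e : R) i : 0 < e ->
  computed (@relu R) i.+1 (fun x => hat p e (x 0 i0)).
Proof.
move=> e0; elim: i => [|i /computed_activation]; last first.
  congr (computed _ _); apply/funext => x.
  by rewrite /relu max_r// hat_ge0.
have := computed_layer (n := 3) (const_mx 1)
  (\row_k [:: - p + e; - p; - p - e]`_k) (\row_k [:: 1; -2; 1]`_k) isT
  (computed_coord (@relu R) i0).
congr (computed _ _); apply/funext => x.
rewrite !big_ord_recl big_ord0 !mxE /= /hat !mul1r addr0 mulNr !addrA.
by [].
Qed.

End VanishingNearby.

(** Finitely many coordinates leave gaps arbitrarily close to [t0]. *)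
Lemma hat_avoiding (R : realType) (S : seq R) (t0 : R) (A : set R) :
  nbhs t0 A ->
  exists p e : R, [/\ 0 < e, A p &
    forall a, a \in S -> \forall t \near a, hat p e t = 0].
Proof.
move=> At0; have [p [Ap pS]] := filter_ex (filterI (nbhs_dnbhs At0) (dnbhs_notin S t0)).
have [e e0 eS] := finite_gap pS; exists p, e; split=> // a /eS ea.
have nea : \forall t \near a, e < `|t - p|.
  have : `|t - p| @[t --> a] --> `|a - p|.
    by apply: cvg_norm; apply: cvgB; [exact: cvg_id|exact: cvg_cst].
  by move/cvgr_gt; exact.
by apply: filterS nea => t /ltW; exact: hat_out.
Qed.

(** * Calculus of C^l functions on the line *)

Section ClCalculus.
Variable R : realType.
Implicit Types (f g : R -> R) (n : nat).

(** Turns the two families of conditions into a recursion on the order, on which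
    the closure properties below are proved by induction. *)
Lemma ClS n f : Cl n.+1 f <->
  [/\ continuous f, forall x, derivable f x 1 & Cl n (derive1 f)].
Proof.
split=> [[df cf]|[cf df [ddf cdf]]].
  split; [exact: (cf 0)|exact: (df 0)|].
  by split=> k kn; rewrite -derive1Sn; [exact: df|exact: cf].
split=> -[|k] kn; [exact: df|rewrite derive1Sn; exact: ddf|exact: cf|].
by rewrite derive1Sn; exact: cdf.
Qed.

Lemma Cl_le m n f : (m <= n)%N -> Cl n f -> Cl m f.
Proof.
move=> mn [df cf]; split=> k km; [apply: df|apply: cf]; exact: leq_trans km mn.
Qed.

Lemma Cl_continuous n f : Cl n f -> continuous f.
Proof. by move=> [_ /(_ 0 (leq0n _))]. Qed.

Lemma Cl_cst n (a : R) : Cl n (fun=> a).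
Proof.
elim: n a => [|n IH] a.
  by split=> // -[]// _; exact: cst_continuous.
apply/ClS; split; [exact: cst_continuous|by move=> x; exact: derivable_cst|].
have -> : derive1 (fun=> a) = (fun=> 0 : R).
  by apply/funext => x; exact: derive1_cst.
exact: IH.
Qed.

Lemma Cl_id n : Cl n (fun x : R => x).
Proof.
case: n => [|n]; first by split=> // -[]// _ x; exact: cvg_id.
apply/ClS; split; [by move=> x; exact: cvg_id|by move=> x; exact: derivable_id|].
have -> : derive1 (fun x : R => x) = (fun=> 1 : R).
  by apply/funext => x; rewrite derive1E derive_id.
exact: Cl_cst.
Qed.

Lemma ClD n f g : Cl n f -> Cl n g -> Cl n (fun x => f x + g x).
Proof.
elim: n f g => [|n IH] f g Cf Cg.
  split=> // -[]// _ x.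
  by apply: cvgD; [exact: (Cl_continuous Cf)|exact: (Cl_continuous Cg)].
have [/ClS[cf df Cf'] /ClS[cg dg Cg']] := (Cf, Cg).
apply/ClS; split.
- by move=> x; apply: cvgD; [exact: cf|exact: cg].
- by move=> x; exact: derivableD.
- have -> : derive1 (fun x => f x + g x) = (fun x => derive1 f x + derive1 g x).
    by apply/funext => x; rewrite !derive1E; exact: deriveD.
  exact: IH.
Qed.

Lemma ClM n f g : Cl n f -> Cl n g -> Cl n (fun x => f x * g x).
Proof.
elim: n f g => [|n IH] f g Cf Cg.
  split=> // -[]// _ x.
  by apply: cvgM; [exact: (Cl_continuous Cf)|exact: (Cl_continuous Cg)].
have [Cfn Cgn] := (Cl_le (leqnSn n) Cf, Cl_le (leqnSn n) Cg).
have [/ClS[cf df Cf'] /ClS[cg dg Cg']] := (Cf, Cg).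
apply/ClS; split.
- by move=> x; apply: cvgM; [exact: cf|exact: cg].
- by move=> x; exact: derivableM.
- have -> : derive1 (fun x => f x * g x) =
      (fun x => f x * derive1 g x + g x * derive1 f x).
    by apply/funext => x; rewrite !derive1E; exact: deriveM.
  by apply: ClD; exact: IH.
Qed.

Lemma Cl_comp n f g : Cl n f -> Cl n g -> Cl n (fun x => g (f x)).
Proof.
elim: n f g => [|n IH] f g Cf Cg.
  split=> // -[]// _ x.
  by apply: continuous_comp; [exact: (Cl_continuous Cf)|exact: (Cl_continuous Cg)].
have Cfn := Cl_le (leqnSn n) Cf.
have [/ClS[cf df Cf'] /ClS[cg dg Cg']] := (Cf, Cg).
apply/ClS; split.
- by move=> x; apply: continuous_comp; [exact: cf|exact: cg].
- move=> x; apply/derivable1_diffP; apply: differentiable_comp.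
    by apply/derivable1_diffP; exact: df.
  by apply/derivable1_diffP; exact: dg.
- have -> : derive1 (fun x => g (f x)) = (fun x => derive1 g (f x) * derive1 f x).
    by apply/funext => x; exact: derive1_comp.
  by apply: ClM; [exact: IH|exact: Cf'].
Qed.

Lemma Cl_sum n m (a : 'I_m -> R) (f : 'I_m -> R -> R) :
  (forall k, Cl n (f k)) -> Cl n (fun x => \sum_k a k * f k x).
Proof.
elim: m a f => [|m IH] a f Cf.
  rewrite (_ : (fun x => _) = fun=> 0); first exact: Cl_cst.
  by apply/funext => x; rewrite big_ord0.
rewrite (_ : (fun x => _) = fun x => a ord0 * f ord0 x +
    \sum_k a (lift ord0 k) * f (lift ord0 k) x); last first.
  by apply/funext => x; rewrite big_ord_recl.
apply: ClD; first by apply: ClM; [exact: Cl_cst|exact: Cf].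
by apply: IH => k; exact: Cf.
Qed.

Lemma derive1n_sum n m (a : 'I_m -> R) (f : 'I_m -> R -> R) :
  (forall k, Cl n (f k)) -> forall j, (j <= n)%N -> forall x,
  derive1n j (fun x => \sum_k a k * f k x) x = \sum_k a k * derive1n j (f k) x.
Proof.
move=> Cf; elim=> [//|j IH] jn x.
rewrite derive1nS derive1E.
have -> : derive1n j (fun x => \sum_k a k * f k x) =
    \sum_k (a k \*: derive1n j (f k)).
  by apply/funext => y; rewrite IH ?(ltnW jn)// fct_sumE.
have df k : derivable (derive1n j (f k)) x 1 by have [d _] := Cf k; exact: d.
rewrite derive_sum; last by move=> k; exact: derivableZ.
by apply: eq_bigr => k _; rewrite (deriveZ _ (df k)) derive1nS derive1E.
Qed.

Lemma derive1n_affine n f (l b : R) : Cl n f -> forall j, (j <= n)%N ->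
  forall x, derive1n j (fun x => f (l * x + b)) x =
            l ^+ j * derive1n j f (l * x + b).
Proof.
move=> [df _]; elim=> [|j IH] jn x; first by rewrite !derive1n0 mul1r.
rewrite derive1nS.
have -> : derive1n j (fun x => f (l * x + b)) =
    (fun x => l ^+ j * derive1n j f (l * x + b)).
  by apply/funext => y; rewrite IH ?(ltnW jn).
have aff : is_derive x 1 (fun x : R => l * x + b) l.
  have dl : derivable (l \*: (id : R -> R)) x 1 by apply: derivableZ; exact: derivable_id.
  have db : derivable (cst b : R -> R) x 1 by exact: derivable_cst.
  apply: DeriveDef; first exact: derivableD dl db.
  rewrite (deriveD dl db) derive_cst addr0 deriveZ; last exact: derivable_id.
  by rewrite derive_id [LHS]mulr1.
have [daff Daff] := aff.
have dfj : derivable (derive1n j f) (l * x + b) 1 by exact: df.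
have dcomp : derivable (derive1n j f \o (fun x : R => l * x + b)) x 1.
  apply: (iffRL (derivable1_diffP _ _)); apply: differentiable_comp.
    exact: (iffLR (derivable1_diffP _ _) daff).
  exact: (iffLR (derivable1_diffP _ _) dfj).
rewrite derive1E; transitivity (l ^+ j * 'D_1 (derive1n j f \o (fun x => l * x + b)) x).
  exact: deriveZ.
rewrite -derive1E (derive1_comp daff dfj) [X in _ * (_ * X)]derive1E Daff.
by rewrite exprSr -mulrA; congr (_ * _); exact: mulrC.
Qed.

End ClCalculus.

Lemma flat_Cl (R : realType) m r (G : R -> R) t : (r <= m)%N -> Cl m G ->
  (forall j, (j <= r)%N -> derive1n j G t = 0) -> flat r G t.
Proof.
move=> rm /(Cl_le rm)[dG cG] G0; split; last exact: G0.
  by near=> t' => j jr; exact: dG.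
by near=> t' => j jr; exact: cG.
Unshelve. all: by end_near.
Qed.

(** * The smooth case: more neurons than equations *)

Section SmoothCombination.
Variable R : realType.
Implicit Types (sigma q : R -> R).

Lemma nonzero_kernel m (M : 'M[R]_(m.+1, m)) :
  exists2 a : 'rV[R]_m.+1, a != 0 & a *m M = 0.
Proof.
have : kermx M != 0.
  by rewrite kermx_eq0 /row_free; apply: contraL (rank_leq_col M) => /eqP ->;
    rewrite ltnn.
by case/rowV0Pn => a /sub_kermxP aM a0; exists a.
Qed.

(** The slopes 0, ..., m - 1 are distinct, hence their Vandermonde matrix is
    invertible. *)
Lemma moments_eq0 m (a : 'rV[R]_m) :
  (forall j, (j < m)%N -> \sum_(k < m) a 0 k * (k%:R : R) ^+ j = 0) -> a = 0.
Proof.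
move=> a_moments; pose b : 'rV[R]_m := \row_k k%:R.
have Vunit : (Vandermonde m b)^T \in unitmx.
  rewrite unitmx_tr unitmxE unitfE det_Vandermonde.
  apply/prodf_neq0 => i _; apply/prodf_neq0 => j ij.
  by rewrite !mxE subr_eq0 eqr_nat neq_ltn ij orbT.
rewrite -[a](mulmxK Vunit) (_ : a *m _ = 0) ?mul0mx//.
apply/rowP => j; rewrite !mxE -[RHS](a_moments j)//.
by apply: eq_bigr => k _; rewrite !mxE.
Qed.

(** The neurons [sigma (k x + s)], [k = 0, ..., m], are linearly independent on
    every neighbourhood of 0: differentiating a vanishing combination [j] times
    at 0 and dividing by the nonzero [sigma^(j) (s)] leaves the [j]-th moment
    of the coefficients. *)
Lemma activation_free m sigma (s : R) (a : 'rV[R]_m.+1) :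
  Cl m sigma -> (forall k, (k <= m)%N -> derive1n k sigma s != 0) ->
  (\forall x \near (0 : R), \sum_k a 0 k * sigma (k%:R * x + s) = 0) -> a = 0.
Proof.
move=> Cs s_neq0 comb0; apply: moments_eq0 => j jm.
have Cf (k : 'I_m.+1) : Cl m (fun x => sigma (k%:R * x + s)).
  apply: (@Cl_comp _ _ (fun x => k%:R * x + s)) => //.
  by apply: ClD; [apply: ClM; [exact: Cl_cst|exact: Cl_id]|exact: Cl_cst].
have := derive1n_near j comb0.
rewrite derive1n_cst0 (derive1n_sum _ Cf jm) => sum0.
apply/eqP; rewrite -(mulIr_eq0 _ (mulIf (s_neq0 j jm))) mulr_suml.
rewrite -[X in _ == X]sum0; apply/eqP/eq_bigr => k _.
by rewrite (derive1n_affine _ _ Cs jm) mulr0 add0r mulrA.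
Qed.

Lemma strictly_monotone_iter n sigma :
  ((0 < n)%N -> strictly_monotone sigma) -> strictly_monotone (iter n sigma).
Proof.
elim: n => [_|n IH mono]; first by left.
have [] := (mono isT, IH (fun _ => mono isT)).
move=> [sup|sdown] [up|down].
- by left=> x y xy; apply: sup; exact: up.
- by right=> x y xy; apply: sup; exact: down.
- by right=> x y xy; apply: sdown; exact: up.
- by left=> x y xy; apply: sdown; exact: down.
Qed.

Lemma Cl_iter m n sigma : Cl m sigma -> Cl m (iter n sigma).
Proof.
move=> Cs; elim: n => [|n IH]; first exact: Cl_id.
exact: Cl_comp IH Cs.
Qed.

(** The image of a neighbourhood under [q] is a neighbourhood, by the
    intermediate value theorem; so a function of [q t] that vanishes for all
    [t] near [t0] vanishes near [q t0]. *)
Lemma strictly_monotone_open q (t0 : R) (A : set R) :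
  continuous q -> strictly_monotone q -> nbhs t0 A ->
  \forall y \near q t0, exists2 t, A t & q t = y.
Proof.
move=> cq mq /nbhs_ballP[e /= e0 eA].
pose a := t0 - e / 2; pose b := t0 + e / 2.
have [at0 t0b] : a < t0 /\ t0 < b.
  by rewrite /a /b ltrBlDr !ltrDl divr_gt0.
have abA t : t \in `[a, b] -> A t.
  rewrite in_itv /= => /andP[ta tb]; apply: eA; rewrite /ball/= ltr_distlC.
  apply/andP; split.
    by apply: lt_le_trans ta; rewrite ltrD2l ltrN2 ltr_pdivrMr// ltr_pMr// ltr1n.
  by apply: le_lt_trans tb _; rewrite ltrD2l ltr_pdivrMr// ltr_pMr// ltr1n.
have minmax : Num.min (q a) (q b) < q t0 < Num.max (q a) (q b).
  rewrite gt_min lt_max; case: mq => mono.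
    by rewrite (mono _ _ at0) (mono _ _ t0b) orbT.
  by rewrite (mono _ _ at0) (mono _ _ t0b) orbT.
have itvy : \forall y \near q t0, y \in `]Num.min (q a) (q b), Num.max (q a) (q b)[.
  by apply: near_in_itvoo; rewrite in_itv.
apply: filterS itvy => y; rewrite in_itv /= => /andP[/ltW ym /ltW yM].
have [|||t tab qt] := @IVT R q a b y; first exact: ltW (lt_trans at0 t0b).
- by apply: continuous_subspaceT.
- by rewrite ym.
- by exists t; [exact: abA|].
Qed.

(** Each pair [(t, j)] of [S] stands for the linear equation [G^(j) (t) = 0] on
    the [m + 1] coefficients of [G]; with at most [m] equations there is a
    nonzero solution.  The function [G] itself is then nonzero arbitrarily
    close to [t0], by [activation_free] applied to the variable
    [iter n sigma t - iter n sigma t0]. *)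
Lemma smooth_combination m sigma (s : R) n (t0 : R) (S : seq (R * nat)) :
  Cl m sigma -> (forall k, (k <= m)%N -> derive1n k sigma s != 0) ->
  ((0 < n)%N -> strictly_monotone sigma) ->
  (size S <= m)%N -> (forall p, p \in S -> (p.2 <= m)%N) ->
  exists a b : 'rV[R]_m.+1,
    let G t := \sum_(k < m.+1) a 0 k * sigma ((\row_k k%:R) 0 k * iter n sigma t + b 0 k) in
    [/\ Cl m G, forall p, p \in S -> derive1n p.2 G p.1 = 0 &
        forall A : set R, nbhs t0 A -> exists2 t, A t & G t != 0].
Proof.
move=> Cs s_neq0 mono sizeS leS; set q := iter n sigma.
have Cq : Cl m q by exact: Cl_iter.
(* these biases make every last-layer neuron have argument [s] at [t0] *)
pose b : 'rV[R]_m.+1 := \row_k (s - k%:R * q t0).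
pose l : 'rV[R]_m.+1 := \row_k k%:R.
pose f (k : 'I_m.+1) t := sigma (l 0 k * q t + b 0 k).
have Cf k : Cl m (f k).
  apply: (@Cl_comp _ _ (fun t => l 0 k * q t + b 0 k)) => //.
  by apply: ClD; [apply: ClM; [exact: Cl_cst|]|exact: Cl_cst].
pose M := \matrix_(k < m.+1, i < m)
  let p := nth (0, 0%N) S i in derive1n p.2 (f k) p.1.
have [a a0 aM] := nonzero_kernel M.
exists a, b => G.
have CG : Cl m G by exact: Cl_sum.
split=> //.
- move=> p pS; rewrite (derive1n_sum _ Cf (leS p pS)).
  have iS : (index p S < m)%N by apply: leq_trans sizeS; rewrite index_mem.
  have /matrixP/(_ 0 (Ordinal iS)) := aM; rewrite !mxE => aM0.
  rewrite -[RHS]aM0; by apply: eq_bigr => k _; rewrite !mxE /= nth_index.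
- move=> A At0; apply: contrapT => noA; move/eqP: a0; apply.
  apply: (activation_free Cs s_neq0).
  have near_q : \forall y \near q t0, exists2 t, A t & q t = y.
    apply: strictly_monotone_open At0; first exact: Cl_continuous Cq.
    exact: strictly_monotone_iter.
  have : \forall x \near (0 : R), exists2 t, A t & q t = q t0 + x.
    have cq0 : q t0 + x @[x --> (0 : R)] --> q t0.
      rewrite -[X in _ --> X]addr0; apply: cvgD; [exact: cvg_cst|exact: cvg_id].
    exact: cq0 near_q.
  apply: filterS => x [t At qt].
  have -> : \sum_k a 0 k * sigma (k%:R * x + s) = G t.
    apply: eq_bigr => k _; congr (_ * sigma _).
    by rewrite !mxE qt mulrDr [_ * q t0 + _]addrC addrACA subrr addr0.
  by apply/eqP/negPn/negP => Gt; apply: noA; exists t.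
Qed.

End SmoothCombination.

(** * The theorem *)

Lemma near_slice (R : realType) (d : nat) (Omega : set 'rV[R]_d) (i0 : 'I_d)
    (x0 : 'rV[R]_d) : open Omega -> Omega x0 ->
  \forall t \near x0 0 i0, exists2 x, Omega x & x 0 i0 = t.
Proof.
move=> openO Ox0; pose shift (t : R) := x0 + (t - x0 0 i0) *: delta_mx 0 i0.
have shift_cvg : shift t @[t --> x0 0 i0] --> x0.
  rewrite -[X in _ --> X]addr0; apply: cvgD; first exact: cvg_cst.
  rewrite -[X in _ --> X](scale0r (delta_mx 0 i0)); apply: cvgZr_tmp.
  by apply/subr_cvg0; exact: cvg_id.
have nO : \forall t \near x0 0 i0, Omega (shift t).
  by apply: shift_cvg; exact: open_nbhs_nbhs.
apply: filterS nO => t Ot; exists (shift t) => //.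
by rewrite /shift !mxE !eqxx mulr1 addrC subrK.
Qed.

Theorem theorem3p5 (R : realType) (d c cF cB NF NB rF rB L : nat) (nu : R)
  (d_gt0 : (0 < d)%N) (c_gt0 : (0 < c)%N)
  (cF_gt0 : (0 < cF)%N) (cB_gt0 : (0 < cB)%N)
  (NF_gt0 : (0 < NF)%N) (NB_gt0 : (0 < NB)%N)
  (nu_ge1 : 1 <= nu)
  (Omega Gamma : set 'rV[R]_d)
  (Omega_dom : bounded_lipschitz_domain Omega)
  (Gamma_sub : Gamma `<=` boundary Omega)
  (F : 'rV[R]_d -> (mindex d rF -> 'rV[R]_c) -> 'rV[R]_cF)
  (B : 'rV[R]_d -> (mindex d rB -> 'rV[R]_c) -> 'rV[R]_cB)
  (Omega_h Gamma_h D_h : {fset 'rV[R]_d})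
  (card_Omega_h : #|` Omega_h| = NF) (card_Gamma_h : #|` Gamma_h| = NB)
  (Omega_h_sub : [set` Omega_h] `<=` Omega)
  (Gamma_h_sub : [set` Gamma_h] `<=` Gamma)
  (D_h_sub : (D_h `<=` Omega_h `|` Gamma_h)%fset)
  (ustar : 'rV[R]_d -> 'rV[R]_c)
  (alphaF alphaB alphaD : R)
  (alphaF_ge0 : 0 <= alphaF) (alphaB_ge0 : 0 <= alphaB)
  (alphaD_ge0 : 0 <= alphaD)
  (omegaF omegaB omegaD : 'rV[R]_d -> R)
  (H : set ('rV[R]_d -> 'rV[R]_c))
  (H_sub : H `<=` node_regular Omega rF rB Omega_h Gamma_h)
  (H_class :
    (H = relu_class Omega (maxn rF rB) L Omega_h Gamma_h /\
     (up_log 2 d.+1 + 1 <= L)%N)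
    \/
    (exists sigma : R -> R,
      let l := (NF * (rF + 1) + NB * (rB + 1))%N in
      [/\ H = smooth_class Omega sigma L,
          Cl l sigma,
          exists a : R, forall k, (k <= l)%N -> derive1n k sigma a != 0,
          (2 <= L)%N &
          (2 < L)%N -> strictly_monotone sigma])) :
  let J := pinn_loss Omega nu F B Omega_h Gamma_h D_h ustar
             alphaF alphaB alphaD omegaF omegaB omegaD in
  argmin H J !=set0 -> infinite_set (argmin H J).
Proof.
move=> J; have [openO _ _ _] := Omega_dom.
pose i0 : 'I_d := Ordinal d_gt0.
have [x0 x0h] : exists x0, x0 \in Omega_h.
  by apply/fset0Pn; rewrite -cardfs_gt0 card_Omega_h.
have slice := near_slice i0 openO (Omega_h_sub _ x0h).
have [[H_eq L_ge]|[sigma [H_eq Cs [s s_neq0] L_ge2 mono]]] := H_class.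
- rewrite H_eq; pose nodes : seq 'rV[R]_d := (Omega_h `|` Gamma_h)%fset.
  (* the set of heights [t] met by the domain is a neighbourhood of that of
     [x0], so the hat can be centred at one of them *)
  have [p [e [e0 [x Ox xp] hat0]]] :=
    hat_avoiding [seq z 0 i0 | z : 'rV[R]_d <- nodes] slice.
  have flat_nodes r z : z \in (Omega_h `|` Gamma_h)%fset ->
      flat r (hat p e) (z 0 i0).
    by move=> zh; apply/flat_near0/hat0/map_f.
  have L_layers : L.-1 = L.-2.+1.
    have := leq_trans (leq_add (_ : 1 <= up_log 2 d.+1)%N (leqnn 1)) L_ge.
    rewrite up_log_gt0 /= ltnS d_gt0 => /(_ isT).
    by case: (L) => [|[]].
  rewrite /relu_class in H_eq *.
  apply: (@infinite_argmin_ridge R d c cF cB rF rB nu c_gt0 Omega Gamma openO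
    Gamma_sub F B Omega_h Gamma_h D_h Omega_h_sub Gamma_h_sub D_h_sub ustar
    alphaF alphaB alphaD omegaF omegaB omegaD _ _ i0 (hat p e)).
  + by rewrite -H_eq.
  + move=> f v [Nf Cf]; split.
      apply: networksD => //; apply: networks_scalel; rewrite L_layers.
      exact: computed_hat.
    move=> z zh; apply: Cr_atD; first exact: Cf.
    by have [] := flat_ridge v (flat_nodes (maxn rF rB) z zh).
  + by move=> z zh; apply: flat_nodes; rewrite in_fsetU zh.
  + by move=> z zh; apply: flat_nodes; rewrite in_fsetU zh orbT.
  + by exists x => //; rewrite xp hat_center// gt_eqF.
- rewrite H_eq; set l := (_ + _)%N in Cs s_neq0.
  (* one equation per node and order of derivation: only derivatives along the
     coordinate [i0] can be nonzero *)
  pose S : seq (R * nat) :=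
    [seq (z 0 i0, j) | z : 'rV[R]_d <- Omega_h, j <- iota 0 (rF + 1)] ++
    [seq (z 0 i0, j) | z : 'rV[R]_d <- Gamma_h, j <- iota 0 (rB + 1)].
  have size_S : size S = l.
    by rewrite size_cat !size_allpairs !size_iota /l -card_Omega_h -card_Gamma_h.
  have rF_le : (rF <= l)%N by rewrite /l; nia.
  have rB_le : (rB <= l)%N by rewrite /l; nia.
  have SF z j : z \in Omega_h -> (j <= rF)%N -> (z 0 i0, j) \in S.
    move=> zh jr; rewrite mem_cat; apply/orP; left; apply/allpairsP.
    by exists (z, j); rewrite mem_iota addn1.
  have SB z j : z \in Gamma_h -> (j <= rB)%N -> (z 0 i0, j) \in S.
    move=> zh jr; rewrite mem_cat; apply/orP; right; apply/allpairsP.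
    by exists (z, j); rewrite mem_iota addn1.
  have S_le q : q \in S -> (q.2 <= l)%N.
    rewrite mem_cat => /orP[] /allpairsP[[z j] [_ /=]];
      rewrite mem_iota add0n addn1 ltnS => /andP[_ jr] ->;
      exact: leq_trans jr _.
  have mono_iter : (0 < L - 2)%N -> strictly_monotone sigma.
    by rewrite subn_gt0.
  have [a [b]] := smooth_combination (x0 0 i0) Cs s_neq0 mono_iter
    (eq_leq size_S) S_le.
  set G := (fun t => _) => -[CG GS GA].
  have [t [x Ox xt] Gt] := GA _ slice.
  have comp_iter n : computed sigma n (fun x => iter n sigma (x 0 i0)).
    elim: n => [|n IH]; [exact: computed_coord|exact: computed_activation].
  apply: (@infinite_argmin_ridge R d c cF cB rF rB nu c_gt0 Omega Gamma openO
    Gamma_sub F B Omega_h Gamma_h D_h Omega_h_sub Gamma_h_sub D_h_sub ustar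
    alphaF alphaB alphaD omegaF omegaB omegaD _ _ i0 G).
  + by move: H_sub; rewrite H_eq.
  + move=> f v Nf; apply: networksD => //; apply: networks_scalel.
    have -> : L.-1 = (L - 2).+1 by rewrite -subSn// subSS subn1.
    exact: computed_layer (comp_iter _).
  + move=> z zh; apply: flat_Cl rF_le CG _ => j jr; exact: (GS _ (SF z j zh jr)).
  + move=> z zh; apply: flat_Cl rB_le CG _ => j jr; exact: (GS _ (SB z j zh jr)).
  + by exists x => //; rewrite xt.
Qed.
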